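(* There exists an absolute constant $\epsilon_0>0$ such that for any $0<\epsilon\le\epsilon_0$: any algorithm that has sample access to an unknown product distribution $P$ over $\{0,1\}^n$ and distinguishes, with probability at least $2/3$, between the cases $P=U$ and $\|P-U\|_1>\epsilon$, requires $\Omega(\sqrt n/\epsilon^2)$ samples, where $U$ is the uniform distribution on $\{0,1\}^n$.
   Context: A product distribution over $\{0,1\}^n$ is one with independent coordinates. $\|P-Q\|_1=\sum_x|P(x)-Q(x)|$. Distinguishing with probability $2/3$ means outputting accept with probability at least $2/3$ when $P=U$ and reject with probability at least $2/3$ when $\|P-U\|_1>\epsilon$. *)

(* Defs.v *)
From HB Require Import structures.
From mathcomp Require Import all_boot all_order all_algebra.
From mathcomp Require Import reals.

Set Implicit Arguments.
Unset Strict Implicit.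
Unset Printing Implicit Defensive.

Import Order.TTheory GRing.Theory Num.Theory.
Local Open Scope ring_scope.

Definition cube (n : nat) := {ffun 'I_n -> bool}.

Definition distribution (R : realType) (T : finType) (P : T -> R) : Prop :=
  (forall x, 0 <= P x) /\ \sum_x P x = 1.

Definition marginal (R : realType) (n : nat) (P : cube n -> R)
    (i : 'I_n) (b : bool) : R :=
  \sum_(x : cube n | x i == b) P x.

(* On a finite product space, mutual independence of all the coordinates is
   the factorization of the point masses through the marginals. *)
Definition product_distribution (R : realType) (n : nat) (P : cube n -> R) :
    Prop :=
  distribution P /\ forall x, P x = \prod_(i < n) marginal P i (x i).

Definition uniform (R : realType) (n : nat) (x : cube n) : R :=
  (#|{: cube n}|%:R)^-1.

Definition l1dist (R : realType) (T : finType) (P Q : T -> R) : R :=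
  \sum_x `|P x - Q x|.

Definition iid (R : realType) (T : finType) (m : nat) (P : T -> R)
    (s : {ffun 'I_m -> T}) : R :=
  \prod_(j < m) P (s j).

(* A randomized algorithm using [m] samples is a Markov kernel from the sample
   sequences to {accept, reject}: [accept A s] is the probability, over the
   internal randomness of [A], that [A] accepts when the samples are [s].  An
   algorithm which may stop before its [m]-th sample is included: it ignores
   the samples it does not draw. *)
Record algorithm (R : realType) (n m : nat) := Algorithm {
  accept :> {ffun 'I_m -> cube n} -> R;
  accept01 : forall s, 0 <= accept s <= 1
}.

Definition Pr_accept (R : realType) (n m : nat) (A : algorithm R n m)
    (P : cube n -> R) : R :=
  \sum_(s : {ffun 'I_m -> cube n}) iid P s * accept A s.

Definition Pr_reject (R : realType) (n m : nat) (A : algorithm R n m)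
    (P : cube n -> R) : R :=
  \sum_(s : {ffun 'I_m -> cube n}) iid P s * (1 - accept A s).

Definition distinguishes_from_uniform (R : realType) (n m : nat)
    (A : algorithm R n m) (eps : R) : Prop :=
  forall P : cube n -> R, product_distribution P ->
    (P =1 uniform R (n := n) -> 2 / 3 <= Pr_accept A P) /\
    (eps < l1dist P (uniform R (n := n)) -> 2 / 3 <= Pr_reject A P).

(* Main.v *)
Require Import Defs.
From HB Require Import structures.
From mathcomp Require Import all_boot all_order all_algebra.
From mathcomp Require Import reals.
From mathcomp Require Import ring lra complex.
Import Order.TTheory GRing.Theory Num.Theory.
Local Open Scope ring_scope.

(** Ingster's second moment method.  For a sign vector [z], let [P_z] be the
product distribution whose i-th coordinate has bias [b z_i], with
[b = 10 eps / sqrt n].  The chi-square distance between the average over [z] of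
[P_z^m] and [U^m] is [(((1 + b^2)^m + (1 - b^2)^m) / 2)^n - 1], which is small
unless [m >= c sqrt n / eps^2], whereas a tester forces it to be at least 1/12.

That [P_z] is [eps]-far from [U] in L1 is seen by integrating against the
complex Riesz product [prod_i (1 + i d z_i x_i)] with [d = 1 / (2 sqrt n)]: it is
bounded by 2, its mean under [U] is 1, and its mean under [P_z] is
[(1 + i b d)^n], whose imaginary part is of order [n b d]. *)

(** * Elementary bounds on real and complex powers *)

(** A division-free form of $(1+x)^n \le 1/(1-nx)$. The induction step uses $(1+x)(1-(n+1)x) =
    1-nx-(n+1)x^2 \le 1-nx$. *)
Lemma exprD1_mul_le1 (R : realFieldType) (x : R) (n : nat) :
  0 <= x -> n%:R * x <= 1 -> (1 + x) ^+ n * (1 - n%:R * x) <= 1.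
Proof.
move=> x0; elim: n => [|n IH]; first by rewrite expr0 mul0r subr0 mulr1.
rewrite -natr1 => nx1.
have n0 : 0 <= n%:R :> R by [].
have nx : n%:R * x <= 1 by nra.
have := IH nx; have : 0 <= (1 + x) ^+ n by apply: exprn_ge0; lra.
rewrite exprS; move: ((1 + x) ^+ n) => y y0 Hy.
have : 0 <= y * (n%:R * x ^+ 2 + x ^+ 2) by rewrite mulr_ge0 ?addr_ge0 ?mulr_ge0 ?sqr_ge0.
lra.
Qed.

(** The sum $S_k$ and the difference $D_k$ satisfy $S_{k+1} = S_k + aD_k$ and $D_{k+1} = D_k +
    aS_k$, so the two bounds are proved by one induction. *)
Lemma expr_even_odd_parts_le (R : realFieldType) (a : R) (k : nat) :
  0 <= a -> k%:R * a <= 1 ->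
  (1 + a) ^+ k + (1 - a) ^+ k <= 2 * (1 + (k%:R * a) ^+ 2) /\
  (1 + a) ^+ k - (1 - a) ^+ k <= 4 * (k%:R * a).
Proof.
move=> a0; elim: k => [|k IH]; first by rewrite !expr0 mul0r; split; lra.
rewrite -natr1 => ka1.
have k0 : 0 <= k%:R :> R by [].
have ka : k%:R * a <= 1 by nra.
have [Hs Hd] := IH ka.
have sq : (k%:R * a) ^+ 2 <= 1 by rewrite expr_le1 // mulr_ge0.
have aD := ler_wpM2l a0 Hd; have aS := ler_wpM2l a0 Hs; have asq := ler_wpM2l a0 sq.
have a2 := sqr_ge0 a.
by rewrite !(exprS _ k); split; lra.
Qed.

(** One more factor subtracts [t] times the imaginary part from the real part and adds [t] times the
    real part to the imaginary part. The real part stays above 3/4, so the imaginary part grows by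
    at least [t / 2] each time. *)
Lemma expr_complex_bounds (R : rcfType) (t : R) (k : nat) :
  0 <= t -> k%:R * t <= 1 / 2 ->
  1 - (k%:R * t) ^+ 2 <= complex.Re ((1 +i* t)%C ^+ k) <= 1 /\
  k%:R * t / 2 <= complex.Im ((1 +i* t)%C ^+ k) <= k%:R * t.
Proof.
move=> t0; elim: k => [|k IH].
  by rewrite expr0 /= !mul0r; split; apply/andP; split; lra.
rewrite -natr1 => kt1.
have k0 : 0 <= k%:R :> R by [].
have kt : k%:R * t <= 1 / 2 by nra.
have [/andP[a1 a2] /andP[a3 a4]] := IH kt.
rewrite (exprS _ k); case: (_ ^+ k) a1 a2 a3 a4 => u v /=.
move=> a1 a2 a3 a4.
have kt0 : 0 <= k%:R * t by rewrite mulr_ge0.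
have sq : (k%:R * t) ^+ 2 <= 1 / 4 by nra.
have b1 := ler_wpM2l t0 a1; have b2 := ler_wpM2l t0 a2.
have b3 := ler_wpM2l t0 a3; have b4 := ler_wpM2l t0 a4.
have tsq := ler_wpM2l t0 sq; have tkt := mulr_ge0 t0 kt0; have t2 := sqr_ge0 t.
by split; apply/andP; split; lra.
Qed.

Lemma normC_Im_le (R : rcfType) (w : R[i]) : ((complex.Im w)%:C <= `|w|)%C.
Proof.
rewrite normc_def lecR (le_trans (ler_norm _)) // -sqrtr_sqr ler_wsqrtr //.
by rewrite lerDr sqr_ge0.
Qed.

Lemma prodr_const_ord (R : pzSemiRingType) (n : nat) (x : R) :
  \prod_(i < n) x = x ^+ n.
Proof. by rewrite prodr_const card_ord. Qed.

(** * Product distributions and the tilted family *)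

Lemma product_distribution_prod (R : realType) (n : nat) (p : 'I_n -> bool -> R) :
  (forall i c, 0 <= p i c) -> (forall i, \sum_c p i c = 1) ->
  product_distribution (fun x : cube n => \prod_(i < n) p i (x i)).
Proof.
move=> p0 p1.
have marg i c : marginal (fun x : cube n => \prod_(i < n) p i (x i)) i c = p i c.
  rewrite /marginal big_mkcond /=.
  (* [F] kills the values other than [c] at coordinate [i], which turns the constrained sum into a
     full sum of products. *)
  pose F (k : 'I_n) (e : bool) := if (k == i) && (e != c) then 0 else p k e.
  transitivity (\sum_(x : cube n) \prod_k F k (x k)).
    apply: eq_bigr => x _; case: eqP => [xi|/eqP xi].
      apply: eq_bigr => k _; rewrite /F.
      by case: eqP => //= ->; rewrite xi eqxx.
    by rewrite (bigD1 i) //= {1}/F eqxx xi mul0r.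
  rewrite -(bigA_distr_bigA F) (bigD1 i) //= [X in _ * X]big1 => [|k ki].
    by rewrite mulr1 big_bool /F eqxx /=; case: (c); rewrite ?addr0 ?add0r.
  by rewrite -[RHS](p1 k); apply: eq_bigr => e _; rewrite /F (negPf ki).
split; last by move=> x; apply: eq_bigr => i _; rewrite marg.
split=> [x|]; first exact: prodr_ge0.
by rewrite -(bigA_distr_bigA p) big1.
Qed.

Section TiltedProducts.
Variable R : realType.

(* The bits [e] and [c] stand for the signs [(-1) ^+ e] and [(-1) ^+ c], so
   [(-1) ^+ (e (+) c)] is the product of the signs. *)
Definition tilted_coord (b : R) (e c : bool) : R :=
  (1 + b * (-1) ^+ (e (+) c)) / 2.

Definition tilted (n : nat) (b : R) (z x : cube n) : R :=
  \prod_(i < n) tilted_coord b (z i) (x i).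

Lemma uniformE (n : nat) (x : cube n) : uniform R x = (2^-1) ^+ n.
Proof. by rewrite /uniform card_ffun card_bool card_ord natrX exprVn. Qed.

Lemma tilted_product (n : nat) (b : R) (z : cube n) :
  0 <= b -> b <= 1 -> product_distribution (tilted n b z).
Proof.
move=> b0 b1; apply: (product_distribution_prod _ _ (fun i => tilted_coord b (z i))).
  by move=> i c; rewrite /tilted_coord; case: (_ (+) _); rewrite ?expr0 ?expr1; lra.
by move=> i; rewrite big_bool /tilted_coord; case: (z i) => /=; rewrite ?expr0 ?expr1; lra.
Qed.

(** Puts the uniform law in the tilted family, so that facts about [tilted] specialise to it. *)
Lemma tilted0 (n : nat) (z x : cube n) : tilted n 0 z x = uniform R x.
Proof.
rewrite uniformE /tilted (eq_bigr (fun=> 2^-1)) => [|i _].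
  by rewrite prodr_const_ord.
by rewrite /tilted_coord mul0r addr0 mul1r.
Qed.

(** * L1 distance to uniform through Riesz products *)

Definition riesz (n : nat) (d : R) (z x : cube n) : R[i] :=
  \prod_(i < n) (1 +i* (d * (-1) ^+ (z i (+) x i)))%C.

(** The sum factors over coordinates. In each one the terms linear in the sign average out and the
    squared sign is 1, which leaves $1 + ibd$. *)
Lemma sum_tilted_riesz (n : nat) (b d : R) (z : cube n) :
  \sum_x (tilted n b z x)%:C%C * riesz n d z x = (1 +i* (b * d))%C ^+ n.
Proof.
transitivity (\prod_(i < n) \sum_c
   ((tilted_coord b (z i) c)%:C * (1 +i* (d * (-1) ^+ (z i (+) c))))%C).
  rewrite bigA_distr_bigA; apply: eq_bigr => x _.
  by rewrite /tilted /riesz rmorph_prod -big_split.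
rewrite (eq_bigr (fun=> (1 +i* (b * d))%C)) => [|i _].
  by rewrite prodr_const_ord.
rewrite big_bool /tilted_coord.
apply/eqP; rewrite eq_complex /=; case: (z i) => /=; rewrite ?expr0 ?expr1.
  by apply/andP; split; apply/eqP; field.
by apply/andP; split; apply/eqP; field.
Qed.

(** Each factor has squared modulus $1+d^2$, and $(1+d^2)^n \le 1/(1-nd^2) \le 4$. *)
Lemma norm_riesz (n : nat) (d : R) (z x : cube n) :
  n%:R * d ^+ 2 <= 3 / 4 -> `|riesz n d z x| <= 2.
Proof.
move=> nd; rewrite -(@ler_pXn2r _ 2) ?nnegrE //.
rewrite /riesz normr_prod -prodrXl (eq_bigr (fun=> (1 + d ^+ 2)%:C%C)) => [|i _].
  rewrite prodr_const_ord -rmorphXn /= -natrX -(rmorph_nat (real_complex R)) lecR.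
  have := exprD1_mul_le1 _ (d ^+ 2) n (sqr_ge0 d).
  have : 0 <= (1 + d ^+ 2) ^+ n by apply: exprn_ge0; rewrite addr_ge0 ?sqr_ge0.
  move: (_ ^+ n) (_ * _) nd => y t; nra.
rewrite -add_Re2_Im2 /= expr1n exprMn.
by congr (1 + _)%:C%C; case: (_ (+) _); rewrite ?expr0 ?expr1 ?sqrrN expr1n mulr1.
Qed.

Lemma l1dist_tilted_ge (n : nat) (b d : R) (z : cube n) :
  0 <= b -> 0 <= d -> n%:R * d ^+ 2 <= 3 / 4 -> n%:R * (b * d) <= 1 / 2 ->
  n%:R * (b * d) / 4 <= l1dist (tilted n b z) (uniform R (n := n)).
Proof.
move=> b0 d0 nd nbd.
have [_ /andP[ImG _]] := expr_complex_bounds _ _ _ (mulr_ge0 b0 d0) nbd.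
set w := _ ^+ n in ImG.
have wE : w - 1 = \sum_x (tilted n b z x - uniform R x)%:C%C * riesz n d z x.
  (* The 1 is the mean of the Riesz product under the uniform law, obtained as the case [b = 0]. *)
  transitivity (w - (1 +i* (0 * d))%C ^+ n).
    by rewrite mul0r (_ : (1 +i* 0)%C = 1) // expr1n.
  rewrite /w -!(sum_tilted_riesz _ _ _ z) -sumrB.
  by apply: eq_bigr => x _; rewrite tilted0 rmorphB mulrBl.
have : (complex.Im w)%:C%C <= ((l1dist (tilted n b z) (uniform R (n := n))) * 2)%:C%C.
  have -> : complex.Im w = complex.Im (w - 1).
    by case: (w) => u v /=; rewrite oppr0 addr0.
  apply: le_trans (normC_Im_le _ _) _.
  rewrite wE (le_trans (ler_norm_sum _ _ _)) //.
  rewrite /l1dist mulr_suml rmorph_sum; apply: ler_sum => x _ /=.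
  rewrite normrM rmorphM /= normc_def /= expr0n addr0 sqrtr_sqr.
  apply: ler_wpM2l; first by rewrite lecR.
  by rewrite rmorph_nat; apply: norm_riesz.
by rewrite lecR; lra.
Qed.

(** * Second moment of the mixture and its consequence for testers *)

Lemma sum_tilted_mul (n : nat) (b : R) (z z' : cube n) :
  \sum_x tilted n b z x * tilted n b z' x =
  (2^-1) ^+ n * \prod_(i < n) (1 + b ^+ 2 * (-1) ^+ (z i (+) z' i)).
Proof.
transitivity (\prod_(i < n) \sum_c tilted_coord b (z i) c * tilted_coord b (z' i) c).
  by rewrite bigA_distr_bigA; apply: eq_bigr => x _; rewrite -big_split.
rewrite -prodr_const_ord -big_split; apply: eq_bigr => i _ /=.
rewrite big_bool /tilted_coord.
by case: (z i); case: (z' i) => /=; rewrite ?expr0 ?expr1; field.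
Qed.

Lemma sum_iid (T : finType) (m : nat) (P : T -> R) :
  \sum_(s : {ffun 'I_m -> T}) iid P s = (\sum_x P x) ^+ m.
Proof.
by rewrite -prodr_const_ord bigA_distr_bigA.
Qed.

Lemma sum_iid_mul (T : finType) (m : nat) (P Q : T -> R) :
  \sum_(s : {ffun 'I_m -> T}) iid P s * iid Q s = (\sum_x P x * Q x) ^+ m.
Proof.
by rewrite -sum_iid; apply: eq_bigr => s _; rewrite /iid -big_split.
Qed.

Definition mixture (n m : nat) (b : R) (s : {ffun 'I_m -> cube n}) : R :=
  (2^-1) ^+ n * \sum_(z : cube n) iid (tilted n b z) s.

Lemma sum_cube_const (n : nat) (a : R) :
  (2^-1) ^+ n * \sum_(z : cube n) a = a.
Proof.
rewrite sumr_const card_ffun card_bool card_ord -[a *+ _]mulr_natr natrX mulrCA -exprMn.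
by rewrite mulVf ?pnatr_eq0 // expr1n mulr1.
Qed.

(** Squaring gives a sum over pairs [z], [z']. For each pair, summing over samples gives the [m]-th
    power of an inner product that factors over coordinates. *)
Lemma sum_mixture_sqr (n m : nat) (b : R) :
  \sum_(s : {ffun 'I_m -> cube n}) mixture n m b s ^+ 2 =
  ((2^-1) ^+ n) ^+ m *
  (((1 + b ^+ 2) ^+ m + (1 - b ^+ 2) ^+ m) / 2) ^+ n.
Proof.
pose h : R := (2^-1) ^+ n.
pose f (e e' : bool) : R := (1 + b ^+ 2 * (-1) ^+ (e (+) e')) ^+ m.
transitivity (h ^+ 2 * \sum_(z : cube n) \sum_(z' : cube n)
                 (h ^+ m * \prod_(i < n) f (z i) (z' i))).
  transitivity (\sum_(s : {ffun 'I_m -> cube n}) h ^+ 2 *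
      \sum_(z : cube n) \sum_(z' : cube n) iid (tilted n b z) s * iid (tilted n b z') s).
    apply: eq_bigr => s _; rewrite /mixture exprMn; congr (_ * _).
    by rewrite expr2 mulr_suml; apply: eq_bigr => z _; rewrite mulr_sumr.
  rewrite -mulr_sumr exchange_big; congr (_ * _); apply: eq_bigr => z _ /=.
  rewrite exchange_big; apply: eq_bigr => z' _ /=.
  by rewrite sum_iid_mul sum_tilted_mul exprMn prodrXl.
(* For fixed [z], the vector of signs [z i (+) z' i] runs over the whole cube, so the value does not
   depend on [z]. *)
have inner (z : cube n) : \sum_(z' : cube n) (h ^+ m * \prod_(i < n) f (z i) (z' i)) =
    h ^+ m * ((1 + b ^+ 2) ^+ m + (1 - b ^+ 2) ^+ m) ^+ n.
  rewrite -mulr_sumr; congr (_ * _).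
  rewrite -(bigA_distr_bigA (fun i c => f (z i) c)) -prodr_const_ord.
  apply: eq_bigr => i _; rewrite big_bool /f.
  by case: (z i) => /=; rewrite expr0 expr1 mulr1 mulrN1 // addrC.
rewrite (eq_bigr _ (fun z _ => inner z)) expr2 -mulrA sum_cube_const.
by rewrite /h exprMn; ring.
Qed.

(* [(w - Q) A <= (w - Q)^2 / w + w A^2 / 4] pointwise, with [A^2 <= 1]. *)
Lemma chi2_test_bound (T : finType) (w : R) (Q A : T -> R) :
  0 < w -> \sum_(s : T) w = 1 -> \sum_s Q s = 1 -> (forall s, 0 <= A s <= 1) ->
  \sum_s w * A s - \sum_s Q s * A s <= w^-1 * (\sum_s Q s ^+ 2) - 1 + 1 / 4.
Proof.
move=> w0 w1 Q1 A01.
have -> : w^-1 * (\sum_s Q s ^+ 2) - 1 + 1 / 4 =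
    \sum_s (w^-1 * Q s ^+ 2 - 2 * Q s + w + w * (1 / 4)).
  by rewrite !big_split /= sumrN -mulr_suml -!mulr_sumr Q1 w1; ring.
rewrite -sumrB; apply: ler_sum => s _.
have /andP[a0 a1] := A01 s.
have wn : w != 0 by rewrite gt_eqF.
have sq : 0 <= w * ((w - Q s) / w - A s / 2) ^+ 2 by rewrite mulr_ge0 ?sqr_ge0 ?ltW.
have A2 : 0 <= w * (1 - A s ^+ 2) by apply: mulr_ge0; [exact: ltW | nra].
have : w * ((w - Q s) / w - A s / 2) ^+ 2 + w * (1 - A s ^+ 2) / 4 =
   w^-1 * Q s ^+ 2 - 2 * Q s + w + w * (1 / 4) - (w * A s - Q s * A s) by field.
lra.
Qed.

(** The tester accepts with probability at least 2/3 under uniform and at most 1/3 under each tilt,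
    hence under the mixture. The gap 1/3 exceeds the 1/4 of [chi2_test_bound] by 1/12. *)
Lemma distinguishing_chi2_ge (n m : nat) (A : algorithm R n m) (eps b : R) :
  0 <= b -> b <= 1 ->
  (forall z, eps < l1dist (tilted n b z) (uniform R (n := n))) ->
  distinguishes_from_uniform A eps ->
  13 / 12 <= (((1 + b ^+ 2) ^+ m + (1 - b ^+ 2) ^+ m) / 2) ^+ n.
Proof.
move=> b0 b1 far dist.
set w : R := ((2^-1) ^+ n) ^+ m.
have w0 : 0 < w by rewrite !exprn_gt0 ?invr_gt0 ?ltr0n.
have iid1 (P : cube n -> R) : product_distribution P ->
    \sum_(s : {ffun 'I_m -> cube n}) iid P s = 1.
  by case=> -[_ P1] _; rewrite sum_iid P1 expr1n.
have iidU (s : {ffun 'I_m -> cube n}) : iid (uniform R (n := n)) s = w.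
  by rewrite /iid (eq_bigr _ (fun j _ => uniformE _ (s j))) prodr_const_ord.
have prodU : product_distribution (uniform R (n := n)).
  have [[t0 t1] tm] := tilted_product n 0 [ffun=> true] (lexx 0) ler01.
  have tU := tilted0 n [ffun=> true].
  split; first split.
  - by move=> x; rewrite -tU.
  - by rewrite -t1; apply: eq_bigr => x _; rewrite tU.
  - move=> x; rewrite -tU tm; apply: eq_bigr => i _; rewrite /marginal.
    by apply: eq_bigr => y _; rewrite tU.
have accU : 2 / 3 <= \sum_(s : {ffun 'I_m -> cube n}) w * A s.
  have [/(_ (fun=> erefl)) + _] := dist _ prodU.
  by rewrite /Pr_accept (eq_bigr (fun s => w * A s)) // => s _; rewrite iidU.
have accz (z : cube n) :
    \sum_(s : {ffun 'I_m -> cube n}) iid (tilted n b z) s * A s <= 1 / 3.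
  have tP := tilted_product n b z b0 b1.
  have [_ /(_ (far z))] := dist _ tP; rewrite /Pr_reject.
  under eq_bigr do rewrite mulrBr mulr1.
  by rewrite sumrB iid1 //; lra.
have accmix : \sum_(s : {ffun 'I_m -> cube n}) mixture n m b s * A s <= 1 / 3.
  rewrite -(sum_cube_const n (1 / 3)) /mixture.
  under eq_bigr do rewrite -mulrA.
  rewrite -mulr_sumr; apply: ler_wpM2l; first by rewrite exprn_ge0 ?invr_ge0.
  under eq_bigr do rewrite mulr_suml.
  by rewrite exchange_big; apply: ler_sum.
have mix1 : \sum_(s : {ffun 'I_m -> cube n}) mixture n m b s = 1.
  rewrite -mulr_sumr exchange_big /= -[RHS](sum_cube_const n); congr (_ * _).
  by apply: eq_bigr => z _; apply: iid1; exact: tilted_product.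
have w1 : \sum_(s : {ffun 'I_m -> cube n}) w = 1.
  by rewrite -(iid1 _ prodU); apply: eq_bigr => s _; rewrite iidU.
have := chi2_test_bound _ _ _ _ w0 w1 mix1 (accept01 A).
rewrite sum_mixture_sqr -/w mulKf ?gt_eqF //; lra.
Qed.

End TiltedProducts.

(** * Choice of parameters and conclusion *)

Theorem theorem4p8 (R : realType) :
  exists eps0 : R, 0 < eps0 /\
  exists c : R, 0 < c /\
    forall eps : R, 0 < eps -> eps <= eps0 ->
    forall (n m : nat) (A : algorithm R n m),
      distinguishes_from_uniform A eps ->
      c * (Num.sqrt n%:R / eps ^+ 2) <= m%:R.
Proof.
(* With $\epsilon \le 1/10$, both $b \le 1$ and $nbd = 5\epsilon \le 1/2$ hold. *)
exists (1 / 10); split; first by lra.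
(* Chosen so that $m b^2 \sqrt n \le 1/10$ when [m] is below the bound. *)
exists (1 / 1000); split; first by lra.
move=> eps e0 e1 n m A dist.
have [->|n0] := posnP n; first by rewrite sqrtr0 mul0r mulr0.
set q := Num.sqrt n%:R.
have q2 : n%:R = q ^+ 2 :> R by rewrite sqr_sqrtr.
have q1 : 1 <= q by rewrite -sqrtr1 ler_wsqrtr // ler1n.
have q0 : q != 0 by rewrite gt_eqF // (lt_le_trans ltr01).
pose b := 10 * eps / q; pose d := 1 / (2 * q).
have bq : b * q = 10 * eps by rewrite /b mulfVK.
have dq : d * q = 1 / 2 by rewrite /d; field.
have b0 : 0 <= b by rewrite divr_ge0 ?mulr_ge0 //; lra.
have d0 : 0 <= d by rewrite divr_ge0 //; lra.
have b1 : b <= 1 by rewrite ler_pdivrMr; lra.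
have nbd : n%:R * (b * d) = 5 * eps.
  by rewrite q2; transitivity ((b * q) * (d * q)); [ring | rewrite bq dq; field].
have nd : n%:R * d ^+ 2 = 1 / 4.
  by rewrite q2; transitivity ((d * q) ^+ 2); [ring | rewrite dq; field].
have far z : eps < l1dist (tilted R n b z) (uniform R (n := n)).
  (* The distance is at least $nbd/4 = 5\epsilon/4 > \epsilon$. *)
  apply: lt_le_trans (l1dist_tilted_ge R n b d z b0 d0 _ _); rewrite ?nbd ?nd; lra.
have := distinguishing_chi2_ge R n m A eps b b0 b1 far dist.
rewrite leNgt => chi; rewrite leNgt; apply/negP => small; move/negP: chi; apply.
have e2 : 0 < eps ^+ 2 by rewrite exprn_gt0.
have m_eps : m%:R * eps ^+ 2 * 1000 <= q.
  by move: small; rewrite mulrA ltr_pdivlMr //; lra.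
set t := m%:R * b ^+ 2.
have tE : t * q ^+ 2 = 100 * (m%:R * eps ^+ 2).
  by rewrite /t -mulrA -exprMn bq; ring.
have m0 : 0 <= m%:R :> R by [].
have t0 : 0 <= t by rewrite mulr_ge0 ?sqr_ge0.
have tq : t * q <= 1 / 10.
  have : (t * q) * q <= 1 / 10 * q by rewrite -mulrA -expr2 tE; lra.
  by rewrite ler_pM2r //; lra.
have t1 : t <= 1 by nra.
have [Ev _] := expr_even_odd_parts_le _ _ m (sqr_ge0 b) t1.
have nt : n%:R * t ^+ 2 <= 1 / 100.
  have tq0 : 0 <= t * q by rewrite mulr_ge0 //; lra.
  by rewrite q2 (_ : _ * _ = (t * q) * (t * q)); [nra | ring].
have B := exprD1_mul_le1 _ _ n (sqr_ge0 t) (le_trans nt _).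
have p0 : 0 <= (1 + t ^+ 2) ^+ n by rewrite exprn_ge0 // addr_ge0 ?sqr_ge0.
(* With $nt^2 \le 1/100$, $(1+t^2)^n \le 100/99 < 13/12$. *)
apply: (@le_lt_trans _ _ ((1 + t ^+ 2) ^+ n)).
  rewrite lerXn2r ?nnegrE ?addr_ge0 ?sqr_ge0 //; last by rewrite -/t in Ev; lra.
  have b21 : b ^+ 2 <= 1 by rewrite expr_le1.
  have b20 := sqr_ge0 b.
  by rewrite divr_ge0 // addr_ge0 // exprn_ge0 //; lra.
by have := B ltac:(lra); move: (_ ^+ n) (n%:R * _) p0 nt => y u; nra.
Qed.
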